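(* Let $P,Q:\mathbf{U}(n)\to\mathbb{C}$ be the complex-valued functions on the unitary group given by the $2\times 2$ determinants $$P(z)=z_{j\alpha}z_{k\beta}-z_{k\alpha}z_{j\beta}\quad\text{and}\quad Q(z)=z_{r\gamma}z_{s\delta}-z_{s\gamma}z_{r\delta}.$$ Further let $f(z)=P(z)/Q(z)$ be the rational function defined on the open and dense subset $W_Q=\{z\in\mathbf{U}(n)\mid Q(z)\neq 0\}$ of the unitary group. Then (a) $f$ is harmonic if and only if $(j,k)=(r,s)$ or $(\alpha,\beta)=(\gamma,\delta)$; (b) $f$ is proper biharmonic if and only if $(j,k)\neq(r,s)$ and $(\alpha,\beta)\neq(\gamma,\delta)$. The corresponding statements hold for the functions induced on $\mathbf{SU}(n)$.
   Context: $\mathbf{U}(n)=\{z\in\mathbf{GL}_n(\mathbb{C})\mid zz^*=I_n\}$ is the unitary group and $\mathbf{SU}(n)=\{z\in\mathbf{U}(n)\mid\det z=1\}$ is the special unitary group. For $z\in\mathbf{U}(n)$, $z_{j\alpha}$ denotes the entry of $z$ in row $j$ and column $\alpha$; Latin indices $j,k,r,s$ refer to rows and Greek indices $\alpha,\beta,\gamma,\delta$ to columns, all in $\{1,\dots,n\}$. Both groups carry the biinvariant Riemannian metric induced by the scalar product $g(Z,W)=\mathrm{Re}\,\mathrm{trace}(ZW^* )$ on the Lie algebra. The function $f$ is invariant under the action $(e^{i\theta},z)\mapsto e^{i\theta}z$ of the circle group on $\mathbf{U}(n)$; the function it induces on $\mathbf{SU}(n)$ is its restriction to $W_Q\cap\mathbf{SU}(n)$.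 For a complex-valued function $f$ on an open subset of a Riemannian manifold, $\tau(f)=\mathrm{div}(\nabla f)$ is the Laplace-Beltrami operator (extended complex-linearly) and $\tau^2(f)=\tau(\tau(f))$. The function $f$ is harmonic if $\tau(f)=0$; it is proper biharmonic if $\tau^2(f)=0$ and $\tau(f)$ does not vanish identically.
   Formalization: The formal statement assumes j≠k, r≠s, α≠β, γ≠δ, (j,k)≠(s,r) and (α,β)≠(δ,γ); otherwise the claim fails (P=0, W_Q empty, or f is up to sign a quotient with equal rows or columns, hence harmonic). Increasing index pairs are covered. *)

(* Defs.v *)
From HB Require Import structures.
From mathcomp Require Import all_boot all_order all_algebra.
From mathcomp Require Import complex.
From mathcomp Require Import all_classical all_reals all_analysis.

Set Implicit Arguments.
Unset Strict Implicit.
Unset Printing Implicit Defensive.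

Import Order.TTheory GRing.Theory Num.Theory numFieldNormedType.Exports.

Local Open Scope classical_set_scope.
Local Open Scope ring_scope.
Local Open Scope complex_scope.
Local Open Scope sesquilinear_scope.

(* The complex numbers are R[i] for an arbitrary R : realType, and functions on
   a group G of matrices are represented by total functions on 'M[R[i]]_n of
   which only the values on G are used.

   Vector fields on G are written in the left trivialization: a function
   V : 'M[R[i]]_n -> 'M[R[i]]_n with values in the Lie algebra stands for the
   vector field whose value at z in G is the tangent vector z *m V z.  Constant
   functions V are thus the left-invariant vector fields. *)

Definition mexp (R : realType) (n : nat) (X : 'M[R[i]]_n) : 'M[R[i]]_n :=
  limn (series (fun k => (k`!%:R)^-1 *: X ^+ k)).

Record matrix_group (R : realType) (n : nat) := MatrixGroup {
  carrier : set 'M[R[i]]_n;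
  lie_algebra : set 'M[R[i]]_n
}.

Definition unitary_group (R : realType) (n : nat) : matrix_group R n :=
  MatrixGroup [set z | z \is unitarymx]
              [set X | X + X ^t* = 0].

Definition special_unitary_group (R : realType) (n : nat) : matrix_group R n :=
  MatrixGroup [set z | z \is unitarymx /\ \det z = 1]
              [set X | X + X ^t* = 0 /\ \tr X = 0].

Section LaplaceBeltrami.
Variables (R : realType) (n : nat) (G : matrix_group R n).
Implicit Types (u : 'M[R[i]]_n -> R) (f : 'M[R[i]]_n -> R[i]).
Implicit Types (V : 'M[R[i]]_n -> 'M[R[i]]_n) (X Y Z z : 'M[R[i]]_n).

(* The scalar product on the Lie algebra.  The left-invariant metric it induces
   assigns to the tangent vectors z *m X and z *m Y at z the number metric X Y. *)
Definition metric X Y : R := complex.Re (\tr (X *m Y ^t*)).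

Definition bracket X Y : 'M[R[i]]_n := X *m Y - Y *m X.

(* The derivative of u at z along the left-invariant vector field of X. *)
Definition lie_deriv u X z : R :=
  derive1 (fun t : R => u (z *m mexp (t%:C *: X))) 0.

Definition lie_deriv_field V X z : 'M[R[i]]_n :=
  \matrix_(a, b) (lie_deriv (fun w => complex.Re (V w a b)) X z
                  +i* lie_deriv (fun w => complex.Im (V w a b)) X z).

Definition gradient u z : 'M[R[i]]_n :=
  xget 0 [set Y | lie_algebra G Y /\
                  forall X, lie_algebra G X -> metric Y X = lie_deriv u X z].

(* By the Koszul formula this is the scalar product with Z of the Levi-Civita
   derivative nabla_X Y, for X, Y, Z left-invariant: the terms of the formula
   that differentiate scalar products of these fields vanish. *)
Definition koszul X Y Z : R :=
  (metric (bracket X Y) Z - metric (bracket Y Z) X + metric (bracket Z X) Y) / 2.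

(* The scalar product with Z of nabla_X V at z, for X, Z left-invariant.
   In a left-invariant frame (E_a), with V = \sum_a v_a E_a, the Leibniz rule
   gives nabla_X V = \sum_a (X v_a) E_a + \sum_a v_a nabla_X E_a. *)
Definition levi_civita V X Z z : R :=
  metric (lie_deriv_field V X z) Z + koszul X (V z) Z.

Definition orthonormal_basis (B : seq 'M[R[i]]_n) : Prop :=
  [/\ forall X, X \in B -> lie_algebra G X,
      forall a b, (a < size B)%N -> (b < size B)%N ->
        metric B`_a B`_b = (a == b)%:R
    & forall X, lie_algebra G X -> X = \sum_(E <- B) (metric X E)%:C *: E].

(* The trace of nabla V; it does not depend on the basis that is chosen. *)
Definition divergence V z : R :=
  \sum_(E <- xget [::] [set B | orthonormal_basis B]) levi_civita V E E z.

Definition laplace u z : R := divergence (gradient u) z.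

Definition tau f z : R[i] :=
  laplace (fun w => complex.Re (f w)) z
  +i* laplace (fun w => complex.Im (f w)) z.

(* In the next two definitions, f is considered on the subset W of G. *)
Definition is_harmonic (W : set 'M[R[i]]_n) f : Prop :=
  forall z, carrier G z -> W z -> tau f z = 0.

Definition is_proper_biharmonic (W : set 'M[R[i]]_n) f : Prop :=
  (forall z, carrier G z -> W z -> tau (tau f) z = 0) /\
  (exists z, [/\ carrier G z, W z & tau f z <> 0]).

End LaplaceBeltrami.

Definition minor2 (R : realType) (n : nat) (j k a b : 'I_n) (z : 'M[R[i]]_n) :
  R[i] := z j a * z k b - z k a * z j b.

(* Main.v *)
Require Import Defs.
From HB Require Import structures.
From mathcomp Require Import all_boot all_order all_algebra.
From mathcomp Require Import complex.
From mathcomp Require Import all_classical all_reals all_analysis.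
From mathcomp Require Import perm fingroup.
From mathcomp Require Import zify ring lra.
Set Implicit Arguments.
Unset Strict Implicit.
Unset Printing Implicit Defensive.
Import Order.TTheory GRing.Theory Num.Theory numFieldNormedType.Exports.
Local Open Scope classical_set_scope.
Local Open Scope ring_scope.
Local Open Scope complex_scope.
Local Open Scope sesquilinear_scope.

(** On a group with a bi-invariant metric the terms nabla_E E vanish, so the
    Laplacian is the sum over an orthonormal basis of the Lie algebra of the
    second derivatives E (E f) along left-invariant fields ([tau_jet]).  Along
    the field of X the coordinates of z have derivative z X, and this holds at
    every matrix z, not only in the group.  All computations therefore take
    place on the open set of matrices where Q is nonzero, and it is never
    necessary to know that the curve z exp(tX) stays in the group.

    Write kappa(u, v) for the sum of the products (E u)(E v) over the basis, so
    that tau(uv) = u tau(v) + 2 kappa(u, v) + v tau(u).  Everything depends on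
    the basis only through the Casimir tensor
      sum_E E_ab E_cd = eps d_ab d_cd - d_ad d_bc,
    where eps = 0 for U(n) and eps = 1/n for SU(n) ([casimir_unitary],
    [casimir_special_unitary]).  For minors it gives ([kappa_minor])
      kappa(P, Q) = 4 eps P Q - S,
    where S ([swap_sum]) is the sum of the four products obtained from P Q by
    exchanging a column of P with a column of Q.  Every minor is an
    eigenfunction of tau, with the same eigenvalue, and the Pluecker relation
    says that S = 2 P Q if P and Q have the same rows, which computes
    kappa(Q, Q).  It follows that
      tau(P / Q) = 2 (S - 2 P Q) / Q^2                        ([tau_quot]);
    eps has cancelled, because P / Q is homogeneous of degree 0, and this is why
    both groups can be treated at once.

    Harmonicity.  If the rows agree or the columns agree, then S = 2 P Q.
    Otherwise S - 2 P Q is nonzero at a suitable special unitary matrix, built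
    from a permutation and, if P and Q share a row or a column, a reflection
    ([witness_exists]).

    Biharmonicity.  Let Omega be the operator P Q |-> S and sigma the exchange
    of both columns of P with those of Q.  On a tensor product of two exterior
    squares Omega has the eigenvalues 2, 0 and -4, on which sigma is 1, -1 and
    1, whence Omega^2 + 2 Omega = 4 + 4 sigma; this evaluates tau(S)
    ([has_lap_swap_sum]).  Together with the value of kappa(S, Q)
    ([kappa_swap_minor]) it makes all terms of tau(tau(P / Q)) cancel
    ([has_lap_lap_quot]). *)

(** * One-parameter subgroups at the identity *)

Section Exp.
Variables (R : realType) (n : nat).
Local Notation C := R[i].
Local Notation re := (@complex.Re R).
Local Notation im := (@complex.Im R).

Lemma ReZ (r : R) (x : C) : re (r%:C * x) = r * re x.
Proof. by case: x => a b /=; rewrite mul0r subr0. Qed.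
Lemma ImZ (r : R) (x : C) : im (r%:C * x) = r * im x.
Proof. by case: x => a b /=; rewrite mul0r addr0. Qed.
Lemma normRe_le (x : C) : (`|re x|)%:C <= `|x|. Proof. exact: normc_ge_Re. Qed.
Lemma re_norm_ge0 (x : C) : 0 <= re `|x|.
Proof. by rewrite -ler0c RRe_real ?normr_real. Qed.
Lemma normci : `|'i%C : C| = 1.
Proof. by rewrite normc_def /= expr0n /= expr1n add0r sqrtr1. Qed.
Lemma normIm_le (x : C) : (`|im x|)%:C <= `|x|.
Proof.
by have := normc_ge_Re (x * 'i%C); rewrite ReiNIm normrN normrM normci mulr1.
Qed.

Let K : numFieldType := C.

(** The order of R[i] is partial: a positive radius is a positive real number, so
    real and imaginary parts can be estimated separately. *)
Lemma cvg_complex (u : nat -> K) (l : K) :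
  (fun k => re (u k)) @ \oo --> re l -> (fun k => im (u k)) @ \oo --> im l ->
  u @ \oo --> l.
Proof.
move=> ua ub; apply/cvgrPdist_lt => -[e e'] /[dup] e0; rewrite ltcE /= => /andP[/eqP e'0 er].
(* e is the real part of the radius, whose imaginary part e' vanishes. *)
have e2 : 0 < e / 2 by rewrite divr_gt0.
move/cvgrPdist_lt : ua => /(_ _ e2) ua.
move/cvgrPdist_lt : ub => /(_ _ e2) ub.
near=> k.
rewrite e'0.
have -> : l - u k = (re l - re (u k))%:C + 'i%C * (im l - im (u k))%:C.
  by case: (l) (u k) => a b [c d]; simpc.
apply: le_lt_trans (ler_normD _ _) _.
rewrite normrM normci mul1r.
rewrite !normc_def /= expr0n /= !addr0 !sqrtr_sqr -rmorphD /= ltcR.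
rewrite [e]splitr ltrD //.
  by near: k; apply: ua.
by near: k; apply: ub.
Unshelve. all: by end_near.
Qed.

Lemma cvg_mx (u : nat -> 'M[K]_n) (L : 'M[K]_n) :
  (forall a b, (fun k => u k a b) @ \oo --> L a b) -> u @ \oo --> L.
Proof.
move=> h A [P LP] PA; apply: filterS PA _.
have : \forall k \near \oo, forall a b, P a b (u k a b).
  apply: filter_forall => a; apply: filter_forall => b; exact: h (LP a b).
by apply: filterS => k /= hk.
Qed.

Section OneMatrix.
Variable X : 'M[C]_n.
Let m : R := \sum_a \sum_b re `|X a b|.

(** The sum of the norms of all entries is a submultiplicative norm that dominates
    each entry. *)
Lemma norm_expmx k a b : `|(X ^+ k) a b| <= (m ^+ k)%:C.
Proof.
have m0 : 0 <= m.
  by apply: sumr_ge0 => i _; apply: sumr_ge0 => j _; exact: re_norm_ge0.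
elim: k a b => [|k IH] a b.
  by rewrite !expr0 mxE; case: eqP => _; rewrite ?normr1 ?normr0 // ler0c.
rewrite exprS mxE; apply: le_trans (ler_norm_sum _ _ _) _.
have -> : (m ^+ k.+1)%:C = \sum_i (\sum_j re `|X i j|)%:C * (m ^+ k)%:C.
  by rewrite exprS rmorphM /= rmorph_sum mulr_suml.
rewrite [leRHS](bigD1 a) //= ler_wpDr //.
  apply: sumr_ge0 => i _; rewrite -rmorphM ler0c mulr_ge0 ?exprn_ge0 //.
  by apply: sumr_ge0 => j _; exact: re_norm_ge0.
rewrite rmorph_sum /= mulr_suml ler_sum // => j _.
by rewrite normrM; exact: ler_wpM2l (normr_ge0 _) _ _ (IH _ _).
Qed.

(** Coefficients of the power series in t of an entry (read through p, the real or
    imaginary part) of the l-th derivative of exp(tX). *)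
Let exp_coef (p : C -> R) a b l (k : nat) : R := k`!%:R^-1 * p ((X ^+ (k + l)%N) a b).

Lemma pseries_diffs_exp_coef p a b l : pseries_diffs (exp_coef p a b l) = exp_coef p a b l.+1.
Proof.
by apply/funext => k; rewrite /pseries_diffs /exp_coef factS natrM invfM addSnnS mulrA mulVKf.
Qed.

(** Domination by an exponential series. *)
Lemma cvg_exp_coef p (pn : forall x, (`|p x|)%:C <= `|x|) a b l x :
  cvgn (pseries (exp_coef p a b l) x).
Proof.
have m0 : 0 <= m.
  by apply: sumr_ge0 => i _; apply: sumr_ge0 => j _; exact: re_norm_ge0.
apply: normed_cvg.
have : cvgn (series (m ^+ l *: exp_coeff (m * `|x|))).
  by apply: is_cvg_seriesZ; exact: is_cvg_series_exp_coeff.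
apply: series_le_cvg => [k|k|k] /=.
- exact: normr_ge0.
- by rewrite /= mulr_ge0 ?exprn_ge0 // exp_coeff_ge0 // mulr_ge0.
have -> : (m ^+ l *: exp_coeff (m * `|x|)) k = (k`!%:R^-1 * m ^+ (k + l)) * `|x| ^+ k.
  by rewrite -[LHS]/(m ^+ l * ((m * `|x|) ^+ k / k`!%:R)) exprMn exprD; ring.
rewrite normrM normrX ler_wpM2r ?exprn_ge0 // /exp_coef normrM.
rewrite ger0_norm ?invr_ge0 // ler_wpM2l ?invr_ge0 //.
rewrite -lecR; apply: le_trans (pn _) _; exact: norm_expmx.
Qed.

(** The matrix limit defining the exponential is computed entrywise, where it is a
    pair of real power series; this makes the termwise differentiation of real
    power series available. *)
Lemma mexpE (t : R) a b : mexp (t%:C *: X) a b =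
  limn (pseries (exp_coef re a b 0) t) +i* limn (pseries (exp_coef im a b 0) t).
Proof.
have powE k : (t%:C *: X) ^+ k = (t ^+ k)%:C *: X ^+ k.
  elim: k => [|k IH]; first by rewrite !expr0 scale1r.
  rewrite !exprS IH -[_ *: X * _]/((_ *: X) *m _) -scalemxAl -scalemxAr scalerA.
  by rewrite -rmorphM.
have termE (p : C -> R) i j (pZ : forall (r : R) x, p (r%:C * x) = r * p x) k :
    p ((k`!%:R^-1 *: (t%:C *: X) ^+ k) i j) = exp_coef p i j 0 k * t ^+ k.
  rewrite powE !mxE /exp_coef addn0.
  have -> : k`!%:R^-1 * ((t ^+ k)%:C * (X ^+ k) i j) = (k`!%:R^-1 * t ^+ k)%:C * (X ^+ k) i j.
    by rewrite rmorphM fmorphV rmorph_nat mulrA.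
  by rewrite pZ mulrAC.
set L := \matrix_(a, b) (limn (pseries (exp_coef re a b 0) t)
                         +i* limn (pseries (exp_coef im a b 0) t)) : 'M[K]_n.
have -> : mexp (t%:C *: X) = L; last by rewrite mxE.
rewrite /mexp; apply: (@cvg_lim 'M[K]_n); first exact: norm_hausdorff.
apply: cvg_mx => i j.
have cvgE (p : C -> R) (pn : forall x, (`|p x|)%:C <= `|x|)
    (pD : {morph p : x y / x + y})
    (pZ : forall (r : R) x, p (r%:C * x) = r * p x) :
  (fun k => p (series (fun k => (k`!%:R)^-1 *: (t%:C *: X) ^+ k) k i j)) @ \oo
    --> limn (pseries (exp_coef p i j 0) t).
  rewrite (_ : (fun k => _) = pseries (exp_coef p i j 0) t); first exact: cvg_exp_coef.
  apply/funext => k; rewrite /pseries /series /=.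
  elim: k => [|k IH].
    by rewrite !big_nil mxE -[RHS](mul0r (p 0)) -pZ mulr0.
  by rewrite !big_nat_recr //= mxE pD IH termE.
apply: cvg_complex; rewrite mxE /=; apply: cvgE.
- exact: normRe_le.
- by case=> ? ? [].
- exact: ReZ.
- exact: normIm_le.
- by case=> ? ? [].
- exact: ImZ.
Qed.

Lemma limn_pseries0 (c : nat -> R) : limn (pseries c 0) = c 0%N.
Proof.
apply: cvg_lim => //; rewrite -(cvg_shiftn 1) /=.
rewrite (_ : (fun k => _) = cst (c 0%N)); first exact: cvg_cst.
apply/funext => k; rewrite /pseries /series /= addn1 big_nat_recl //= expr0 mulr1.
by rewrite big1 ?addr0 // => l _; rewrite exprS mul0r mulr0.
Qed.

Lemma mexp0 : mexp ((0 : R)%:C *: X) = 1%:M.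
Proof.
apply/matrixP => a b; rewrite mexpE !limn_pseries0 /exp_coef fact0 invr1 !mul1r expr0 /=.
by case: (_ a b).
Qed.

Lemma is_derive_mexp a b :
  is_derive (0 : R) (1 : R) (fun t : R => re (mexp (t%:C *: X) a b)) (re (X a b)) /\
  is_derive (0 : R) (1 : R) (fun t : R => im (mexp (t%:C *: X) a b)) (im (X a b)).
Proof.
have key (p : C -> R) (pn : forall x, (`|p x|)%:C <= `|x|) :
    is_derive (0 : R) (1 : R) (fun t : R => limn (pseries (exp_coef p a b 0) t)) (p (X a b)).
  have -> : p (X a b) = limn (pseries (pseries_diffs (exp_coef p a b 0)) 0).
    by rewrite limn_pseries0 pseries_diffs_exp_coef /exp_coef fact0 invr1 mul1r expr1.
  apply: (@pseries_snd_diffs _ _ 1); rewrite ?pseries_diffs_exp_coef; try exact: cvg_exp_coef.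
  by rewrite normr0 normr1.
split; [have := key _ normRe_le | have := key _ normIm_le];
  by congr (is_derive _ _ _ _); apply/funext => t; rewrite mexpE.
Qed.

End OneMatrix.

End Exp.

(** * Derivatives along left-invariant vector fields *)

Section LieDer.
Variables (R : realType) (n : nat).
Local Notation C := R[i].
Local Notation re := (@complex.Re R).
Local Notation im := (@complex.Im R).
Implicit Types (h : R -> C) (f g : 'M[C]_n -> C) (X z : 'M[C]_n) (d e : C).

(** Real and imaginary parts are kept apart because the Laplacian of a complex
    function is defined through them. *)
Definition cderive0 h d : Prop :=
  is_derive (0 : R) (1 : R) (fun t => re (h t)) (re d) /\
  is_derive (0 : R) (1 : R) (fun t => im (h t)) (im d).

Lemma cderive0_near h1 h2 d : (\forall t \near (0 : R), h1 t = h2 t) ->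
  cderive0 h1 d -> cderive0 h2 d.
Proof.
by move=> e [h1r h1i]; split; [apply: near_eq_is_derive h1r | apply: near_eq_is_derive h1i];
  apply: filterS e => t ->.
Qed.

Lemma cderive0_cst d : cderive0 (fun=> d) 0.
Proof. by split; exact: is_derive_cst. Qed.

Lemma cderive0D h1 h2 d1 d2 : cderive0 h1 d1 -> cderive0 h2 d2 ->
  cderive0 (fun t => h1 t + h2 t) (d1 + d2).
Proof.
move=> [r1 i1] [r2 i2]; split.
  rewrite [X in is_derive _ _ X](_ : _ = (fun t => re (h1 t)) + (fun t => re (h2 t))).
    have -> : re (d1 + d2) = re d1 + re d2 by case: d1 d2 {r1 r2 i1 i2} => ? ? [].
    exact: is_deriveD.
  by apply/funext => t; rewrite !fctE; case: (h1 t) (h2 t) => ? ? [].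
rewrite [X in is_derive _ _ X](_ : _ = (fun t => im (h1 t)) + (fun t => im (h2 t))).
  have -> : im (d1 + d2) = im d1 + im d2 by case: d1 d2 {r1 r2 i1 i2} => ? ? [].
  exact: is_deriveD.
by apply/funext => t; rewrite !fctE; case: (h1 t) (h2 t) => ? ? [].
Qed.

Lemma cderive0M h1 h2 d1 d2 : cderive0 h1 d1 -> cderive0 h2 d2 ->
  cderive0 (fun t => h1 t * h2 t) (d1 * h2 0 + h1 0 * d2).
Proof.
move=> [r1 i1] [r2 i2]; split.
  rewrite [X in is_derive _ _ X](_ : _ = (fun t => re (h1 t)) * (fun t => re (h2 t))
     - (fun t => im (h1 t)) * (fun t => im (h2 t))).
    apply: (is_derive_eq (is_deriveB (is_deriveM r1 r2) (is_deriveM i1 i2))).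
    case: d1 d2 (h1 0) (h2 0) {r1 r2 i1 i2} => ? ? [] ? ? [] ? ? [] ? ? /=.
    by rewrite /GRing.scale /=; ring.
  by apply/funext => t; rewrite !fctE; case: (h1 t) (h2 t) => ? ? [].
rewrite [X in is_derive _ _ X](_ : _ = (fun t => re (h1 t)) * (fun t => im (h2 t))
     + (fun t => im (h1 t)) * (fun t => re (h2 t))).
  apply: (is_derive_eq (is_deriveD (is_deriveM r1 i2) (is_deriveM i1 r2))).
  case: d1 d2 (h1 0) (h2 0) {r1 r2 i1 i2} => ? ? [] ? ? [] ? ? [] ? ? /=.
  by rewrite /GRing.scale /=; ring.
by apply/funext => t; rewrite !fctE; case: (h1 t) (h2 t) => ? ? [].
Qed.

Lemma cderive0_neq0 h d : h 0 != 0 -> cderive0 h d -> \forall t \near (0 : R), h t != 0.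
Proof.
move=> h0 [[/derivable1_diffP/differentiable_continuous hr _]].
move=> [/derivable1_diffP/differentiable_continuous hi _].
have [r0|r0] := eqVneq (re (h 0)) 0.
  have i0 : im (h 0) != 0 by move: h0 r0; case: (h 0) => a b /= + a0; rewrite a0 eq_complex /= eqxx.
  apply: filterS (@cvgr_neq0 _ _ _ _ _ _ _ hi i0) => t; apply: contraNneq.
  by rewrite /= => ->.
apply: filterS (@cvgr_neq0 _ _ _ _ _ _ _ hr r0) => t; apply: contraNneq.
by rewrite /= => ->.
Qed.

(** Inversion is differentiated through the real and imaginary parts of
    1 / (a + ib), whose common denominator is N = a^2 + b^2. *)
Lemma cderive0V h d : h 0 != 0 -> cderive0 h d -> cderive0 (fun t => (h t)^-1) (- (d / (h 0) ^+ 2)).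
Proof.
move=> h0 [hr hi].
pose N := (fun t => re (h t)) * (fun t => re (h t)) + (fun t => im (h t)) * (fun t => im (h t)).
have N0 : N 0 != 0.
  move: h0; rewrite /N !fctE; case: (h 0) => a b; rewrite eq_complex /= -!expr2.
  by rewrite paddr_eq0 ?sqr_ge0 // !sqrf_eq0.
have [dN DN] := is_deriveD (is_deriveM hr hr) (is_deriveM hi hi).
have dV : is_derive (0 : R) (1 : R) (fun t => (N t)^-1) (- (N 0) ^- 2 *: 'D_1 N 0).
  by apply: DeriveDef; [exact: derivableV | exact: deriveV].
rewrite {}DN in dV; split.
  rewrite [X in is_derive _ _ X](_ : _ = (fun t => re (h t)) * (fun t => (N t)^-1)).
    apply: (is_derive_eq (is_deriveM hr dV)); move: N0; rewrite /N !fctE.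
    case: d (h 0) {hr hi dN dV h0} => d1 d2 [] a b /=; rewrite -!expr2 => N0.
    rewrite /GRing.scale /=; field; rewrite N0 andbT.
    rewrite (_ : _ + _ = (a ^+ 2 + b ^+ 2) ^+ 2); last by ring.
    by rewrite expf_neq0.
  by apply/funext => t; rewrite /N !fctE -!expr2; case: (h t).
rewrite [X in is_derive _ _ X](_ : _ = - (fun t => im (h t)) * (fun t => (N t)^-1)).
  apply: (is_derive_eq (is_deriveM (is_deriveN hi) dV)); move: N0; rewrite /N !fctE.
  case: d (h 0) {hr hi dN dV h0} => d1 d2 [] a b /=; rewrite -!expr2 => N0.
  rewrite /GRing.scale /=; field; rewrite N0 andbT.
  rewrite (_ : _ + _ = (a ^+ 2 + b ^+ 2) ^+ 2); last by ring.
  by rewrite expf_neq0.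
by apply/funext => t; rewrite /N !fctE -!expr2; case: (h t) => a b /=; rewrite mulNr.
Qed.

Lemma cderive0_sum (I : Type) (s : seq I) (h : I -> R -> C) (d : I -> C) :
  (forall i, cderive0 (h i) (d i)) ->
  cderive0 (fun t => \sum_(i <- s) h i t) (\sum_(i <- s) d i).
Proof.
move=> hd; elim: s => [|i s IH].
  by rewrite big_nil; under eq_fun do rewrite big_nil; exact: cderive0_cst.
by rewrite big_cons; under eq_fun do rewrite big_cons; exact: cderive0D.
Qed.

Lemma cderive0_eq h d d' : cderive0 h d -> d = d' -> cderive0 h d'.
Proof. by move=> + <-. Qed.

Lemma cderive0_cstM e h d : cderive0 h d -> cderive0 (fun t => e * h t) (e * d).
Proof. by move=> /(cderive0M (cderive0_cst e)) /cderive0_eq; apply; rewrite mul0r add0r. Qed.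

Lemma cderive0Mcst e h d : cderive0 h d -> cderive0 (fun t => h t * e) (d * e).
Proof. by move=> /cderive0M /(_ (cderive0_cst e)) /cderive0_eq; apply; rewrite mulr0 addr0. Qed.

(** The relational form of the derivative of f at z along X: it asserts
    differentiability together with the value, so that the usual rules of calculus
    compose. *)
Definition lie_derive f X z d := cderive0 (fun t : R => f (z *m mexp (t%:C *: X))) d.

Lemma lie_derive_near f g X z d :
  (\forall t \near (0 : R), f (z *m mexp (t%:C *: X)) = g (z *m mexp (t%:C *: X))) ->
  lie_derive f X z d -> lie_derive g X z d.
Proof. exact: cderive0_near. Qed.

Lemma lie_derive_eq f X z d d' : lie_derive f X z d -> d = d' -> lie_derive f X z d'.
Proof. exact: cderive0_eq. Qed.

Lemma mul_mexp0 f X z : f (z *m mexp ((0 : R)%:C *: X)) = f z.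
Proof. by rewrite mexp0 mulmx1. Qed.

Lemma lie_deriveD f g X z d e : lie_derive f X z d -> lie_derive g X z e ->
  lie_derive (fun w => f w + g w) X z (d + e).
Proof. exact: cderive0D. Qed.

Lemma lie_deriveM f g X z d e : lie_derive f X z d -> lie_derive g X z e ->
  lie_derive (fun w => f w * g w) X z (d * g z + f z * e).
Proof. by move=> hf hg; apply: cderive0_eq (cderive0M hf hg) _; rewrite /= !mul_mexp0. Qed.

Lemma lie_deriveV f X z d : f z != 0 -> lie_derive f X z d ->
  lie_derive (fun w => (f w)^-1) X z (- (d / (f z) ^+ 2)).
Proof.
by move=> fz hf; apply: cderive0_eq (cderive0V _ hf) _; rewrite /= ?mul_mexp0.
Qed.

Lemma lie_derive_cstM e f X z d : lie_derive f X z d -> lie_derive (fun w => e * f w) X z (e * d).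
Proof. exact: cderive0_cstM. Qed.

(** The derivative of exp(tX) at t = 0 is X; the point z is an arbitrary matrix. *)
Lemma lie_derive_coord a b X z : lie_derive (fun w => w a b) X z ((z *m X) a b).
Proof.
rewrite mxE /lie_derive; under eq_fun do rewrite mxE.
by apply: cderive0_sum => j; apply: cderive0_cstM; exact: is_derive_mexp.
Qed.

Lemma lie_derive_neq0 f X z d : f z != 0 -> lie_derive f X z d ->
  \forall t \near (0 : R), f (z *m mexp (t%:C *: X)) != 0.
Proof. by move=> fz; apply: cderive0_neq0; rewrite mul_mexp0. Qed.

End LieDer.

(** * Orthonormal bases of real spaces of matrices *)

Section Metric.
Variables (R : realType) (n : nat).
Local Notation C := R[i].
Local Notation re := (@complex.Re R).
Local Notation im := (@complex.Im R).
Implicit Types (X Y Z M E : 'M[C]_n) (B : seq 'M[C]_n).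

Lemma metricE X Y :
  metric X Y = \sum_i \sum_j (re (X i j) * re (Y i j) + im (X i j) * im (Y i j)).
Proof.
have reD : {morph re : x y / x + y} by case=> ? ? [].
rewrite /metric /mxtrace (big_morph _ reD (erefl _)); apply: eq_bigr => i _.
rewrite mxE (big_morph _ reD (erefl _)); apply: eq_bigr => j _.
rewrite !mxE -[Num.conj _]/((Y i j)^*%C); case: (X i j) (Y i j) => a b [c d] /=.
by rewrite mulrN opprK.
Qed.

Lemma metricC X Y : metric X Y = metric Y X.
Proof.
rewrite !metricE; apply: eq_bigr => i _; apply: eq_bigr => j _; ring.
Qed.

Lemma metricDZl (a : R) X Y Z : metric (a%:C *: X + Y) Z = a * metric X Z + metric Y Z.
Proof.
rewrite !metricE mulr_sumr -big_split; apply: eq_bigr => i _.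
rewrite mulr_sumr -big_split; apply: eq_bigr => j _ /=; rewrite !mxE.
by case: (X i j) (Y i j) (Z i j) => ? ? [] ? ? [] ? ? /=; ring.
Qed.

Lemma metric0l Z : metric 0 Z = 0.
Proof.
by rewrite metricE big1 // => i _; rewrite big1 // => j _; rewrite mxE /= !mul0r addr0.
Qed.

Lemma metricZl (a : R) X Z : metric (a%:C *: X) Z = a * metric X Z.
Proof. by rewrite -[_ *: X]addr0 metricDZl metric0l addr0. Qed.

Lemma metricDl X Y Z : metric (X + Y) Z = metric X Z + metric Y Z.
Proof. by rewrite -[X]scale1r -[1]/((1 : R)%:C) metricDZl mul1r scale1r. Qed.

Lemma metricNl X Z : metric (- X) Z = - metric X Z.
Proof.
have := metricZl (-1) X Z; rewrite rmorphN rmorph1 scaleN1r => ->; by rewrite mulN1r.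
Qed.

Lemma metric_suml (I : Type) (s : seq I) (c : I -> R) (F : I -> 'M[C]_n) Z :
  metric (\sum_(i <- s) (c i)%:C *: F i) Z = \sum_(i <- s) c i * metric (F i) Z.
Proof.
elim: s => [|i s IH]; first by rewrite !big_nil metric0l.
by rewrite !big_cons metricDZl IH.
Qed.

Lemma metric_ge0 X : 0 <= metric X X.
Proof.
by rewrite metricE; apply: sumr_ge0 => i _; apply: sumr_ge0 => j _;
  rewrite addr_ge0 // -expr2 sqr_ge0.
Qed.

Lemma metric_eq0 X : metric X X = 0 -> X = 0.
Proof.
have pos x y : 0 <= re (X x y) * re (X x y) + im (X x y) * im (X x y).
  by rewrite addr_ge0 // -expr2 sqr_ge0.
rewrite metricE => /eqP; rewrite psumr_eq0; last by move=> i _; exact: sumr_ge0.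
move=> /allP h; apply/matrixP => i j; rewrite mxE.
have /h := mem_index_enum i; rewrite /= psumr_eq0 // => /allP /(_ j (mem_index_enum _)) /=.
rewrite -!expr2 paddr_eq0 ?sqr_ge0 // !sqrf_eq0.
by case: (X i j) => a b /= /andP[/eqP-> /eqP->].
Qed.

Definition orthonormal B := forall a b, (a < size B)%N -> (b < size B)%N ->
  metric B`_a B`_b = (a == b)%:R.

Lemma orthonormal_sum B (c : 'M[C]_n -> R) b : orthonormal B -> (b < size B)%N ->
  metric (\sum_(E <- B) (c E)%:C *: E) B`_b = c B`_b.
Proof.
move=> oB bB; rewrite metric_suml (big_nth 0) big_mkord (bigD1 (Ordinal bB)) //=.
rewrite oB // eqxx mulr1 big1 ?addr0 // => i ib; rewrite oB //.
by rewrite (negbTE (_ : (i : nat) != b)) ?mulr0.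
Qed.

Lemma bessel B M : orthonormal B -> \sum_(E <- B) metric M E ^+ 2 <= metric M M.
Proof.
move=> oB; set P := \sum_(E <- B) (metric M E)%:C *: E.
have MP : metric M P = \sum_(E <- B) metric M E ^+ 2.
  by rewrite metricC metric_suml; apply: eq_bigr => E _; rewrite metricC expr2.
have PP : metric P P = \sum_(E <- B) metric M E ^+ 2.
  rewrite {1}/P metric_suml [LHS](big_nth 0) [RHS](big_nth 0) !big_mkord; apply: eq_bigr => i _.
  by rewrite [X in _ * X]metricC orthonormal_sum // expr2.
have := metric_ge0 (M - P).
rewrite metricDl metricNl [metric M (_ - _)]metricC [metric P (_ - _)]metricC.
by rewrite !metricDl !metricNl [metric P M]metricC MP PP; lra.
Qed.

(** Summing the Bessel inequality over the 2 n^2 matrices with a single nonzero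
    entry, 1 or i, gives the sum of the squared norms of the members of B. *)
Lemma orthonormal_size B : orthonormal B -> (size B <= (n * n).*2)%N.
Proof.
move=> oB; rewrite -(ler_nat R).
have dre i j E : metric (delta_mx i j) E = re (E i j).
  rewrite metricE (bigD1 i) //= (bigD1 j) //= !mxE !eqxx /= big1 => [|k kj].
    rewrite big1 ?mul1r ?mul0r ?addr0 // => k ki; rewrite big1 // => l _.
    by rewrite mxE (negbTE ki) /= !mul0r addr0.
  by rewrite mxE (negbTE kj) andbF /= !mul0r addr0.
have dim i j E : metric ('i%C *: delta_mx i j) E = im (E i j).
  rewrite metricE (bigD1 i) //= (bigD1 j) //= !mxE !eqxx /= big1 => [|k kj].
    rewrite big1 ?mul1r ?mul0r ?mulr0 ?subrr ?mul0r ?add0r ?addr0 ?mul1r // => k ki.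
    rewrite big1 // => l _; by rewrite !mxE (negbTE ki) /= !mulr0 subr0 addr0 !mul0r addr0.
  by rewrite !mxE (negbTE kj) andbF /= !mulr0 subr0 addr0 !mul0r addr0.
have -> : (size B)%:R = \sum_(E <- B) \sum_i \sum_j
    (metric (delta_mx i j) E ^+ 2 + metric ('i%C *: delta_mx i j) E ^+ 2) :> R.
  transitivity (\sum_(E <- B) metric E E); last first.
    apply: eq_bigr => E _; rewrite metricE; apply: eq_bigr => i _.
    by apply: eq_bigr => j _; rewrite dre dim !expr2.
  rewrite (big_nth 0) big_mkord (eq_bigr (fun=> 1)) => [|i _]; last by rewrite oB // eqxx.
  by rewrite sumr_const card_ord.
rewrite exchange_big /=.
have -> : ((n * n).*2)%:R = \sum_(i < n) \sum_(j < n) (1 + 1) :> R.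
  by rewrite !sumr_const !card_ord -!mulrnA -mulr2n -!mulrnA mul2n.
apply: ler_sum => i _; rewrite exchange_big /=; apply: ler_sum => j _.
rewrite big_split /= lerD //; apply: le_trans (bessel _ oB) _.
  by rewrite dre mxE !eqxx.
by rewrite dim !mxE !eqxx /= mul0r mulr1 add0r.
Qed.

Section Basis.
Variable L : set 'M[C]_n.
Hypotheses (L0 : L 0) (LDZ : forall (a : R) X Y, L X -> L Y -> L (a%:C *: X + Y)).

Lemma real_span_sum (I : eqType) (s : seq I) (c : I -> R) (F : I -> 'M[C]_n) :
  (forall i, i \in s -> L (F i)) -> L (\sum_(i <- s) (c i)%:C *: F i).
Proof.
elim: s => [|i s IH] h; first by rewrite big_nil.
rewrite big_cons; apply: LDZ; first by apply: h; rewrite mem_head.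
by apply: IH => j js; apply: h; rewrite in_cons js orbT.
Qed.

(** An orthonormal sequence of maximal length in L is a basis: otherwise the
    normalized residual of some X could be added to it. *)
Lemma orthonormal_basis_exists : exists B, [/\ forall X, X \in B -> L X,
   orthonormal B & forall X, L X -> X = \sum_(E <- B) (metric X E)%:C *: E].
Proof.
pose S k := `[< exists B, [/\ size B = k, forall X, X \in B -> L X & orthonormal B] >].
have S0 : exists k, S k by exists 0%N; apply/asboolP; exists [::].
have Sb k : S k -> (k <= (n * n).*2)%N.
  by move=> /asboolP[B [<- _ oB]]; exact: orthonormal_size.
case: (ex_maxnP S0 Sb) => k /asboolP[B [Bk BL oB]] kmax.
exists B; split=> // X LX; apply/eqP; rewrite -subr_eq0; apply/negP => /negP.
set Y := X - _ => Y0.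
have LY : L Y.
  have := LDZ (-1) (real_span_sum (fun E => metric X E) BL) LX.
  by rewrite rmorphN rmorph1 scaleN1r addrC.
have YB b : (b < size B)%N -> metric Y B`_b = 0.
  by move=> bB; rewrite /Y metricDl metricNl (orthonormal_sum (fun E => metric X E)) // subrr.
have YY : 0 < metric Y Y.
  rewrite lt_def metric_ge0 andbT; apply: contra_neq Y0; exact: metric_eq0.
pose r := (Num.sqrt (metric Y Y))^-1.
have rYY : r * (r * metric Y Y) = 1.
  by rewrite mulrA -expr2 exprVn sqr_sqrtr ?ltW // mulVf // gt_eqF.
have /kmax : S k.+1.
  apply/asboolP; exists (r%:C *: Y :: B); split=> /=; first by rewrite Bk.
    move=> Z; rewrite in_cons => /predU1P[->|]; last exact: BL.
    by rewrite -[_ *: _]addr0; apply: LDZ.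
  move=> [|a] [|b] //=; rewrite ?ltnS => aB bB.
  - by rewrite metricZl metricC metricZl.
  - by rewrite metricZl YB ?mulr0.
  - by rewrite metricC metricZl YB ?mulr0.
  - by rewrite oB.
by rewrite ltnn.
Qed.
End Basis.

End Metric.

(** * The Casimir tensor of the unitary groups *)

Section Casimir.
Variables (R : realType) (n : nat).
Local Notation C := R[i].
Local Notation re := (@complex.Re R).
Local Notation im := (@complex.Im R).
Implicit Types (X Y Z M E : 'M[C]_n) (B : seq 'M[C]_n).

Lemma trmxC_mul X Y : (X *m Y) ^t* = Y ^t* *m X ^t*.
Proof. by rewrite trmx_mul map_mxM. Qed.

Lemma tr_trmxC X : \tr (X ^t*) = (\tr X)^*%C.
Proof.
rewrite /mxtrace rmorph_sum; apply: eq_bigr => i _; by rewrite !mxE.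
Qed.

(** For skew-Hermitian matrices the trace of X E is real, so the scalar product is
    complex bilinear; this is what allows expansions to be complexified. *)
Lemma metric_skew X E : X + X ^t* = 0 -> E + E ^t* = 0 ->
  (metric X E)%:C = - \tr (X *m E).
Proof.
move=> /eqP; rewrite addrC addr_eq0 => /eqP sX /eqP; rewrite addrC addr_eq0 => /eqP sE.
have trR : (\tr (X *m E))^*%C = \tr (X *m E).
  by rewrite -tr_trmxC trmxC_mul sX sE mulmxN mulNmx opprK mxtrace_mulC.
rewrite /metric sE mulmxN raddfN /=.
by move: trR; case: (\tr _) => a b /= [] e; congr (_ +i* _); lra.
Qed.

Definition casimir (eps : C) B := forall a b c d,
  \sum_(E <- B) E a b * E c d
    = eps * (a == b)%:R * (c == d)%:R - (a == d)%:R * (b == c)%:R.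

(** Every matrix is A + iB with A and B skew-Hermitian, as the complexification of
    the Lie algebra of U(n) is the space of all matrices. *)
Definition skew_re M : 'M[C]_n := 2^-1 *: (M - M ^t*).
Definition skew_im M : 'M[C]_n := (2 * 'i%C)^-1 *: (M + M ^t*).

Lemma ci_neq0 : 'i%C != 0 :> C.
Proof. by rewrite eq_complex /= oner_eq0 andbF. Qed.

Lemma skewK M : skew_re M + 'i%C *: skew_im M = M.
Proof.
apply/matrixP => i j; rewrite !mxE; field; exact: ci_neq0.
Qed.

Lemma conjci : Num.conj ('i%C : C) = - 'i%C.
Proof. by rewrite -[LHS]/(('i%C : C)^*%C) /=; simpc. Qed.

Lemma skew_reP M : skew_re M + (skew_re M) ^t* = 0.
Proof.
apply/matrixP => i j; rewrite !mxE. rewrite rmorphM fmorphV rmorph_nat rmorphB /= conjCK.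
by field.
Qed.

Lemma skew_imP M : skew_im M + (skew_im M) ^t* = 0.
Proof.
apply/matrixP => i j; rewrite !mxE rmorphM fmorphV rmorphM rmorph_nat rmorphD /= conjCK conjci.
by field; exact: ci_neq0.
Qed.

(** The expansion of the elements of the Lie algebra in an orthonormal basis is
    complex linear by [metric_skew], hence extends to its complexification. *)
Lemma basis_expansion (G : matrix_group R n) B M :
  (forall X, lie_algebra G X -> X + X ^t* = 0) -> orthonormal_basis G B ->
  lie_algebra G (skew_re M) -> lie_algebra G (skew_im M) ->
  M = - \sum_(E <- B) \tr (M *m E) *: E.
Proof.
move=> sG [BL _ Bexp] LM LM'.
have key X : lie_algebra G X -> X = - \sum_(E <- B) \tr (X *m E) *: E.
  move=> LX; rewrite {1}(Bexp _ LX) -sumrN !big_seq; apply: eq_bigr => E /BL LE.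
  by rewrite metric_skew ?scaleNr //; exact: sG.
rewrite -{1}[M]skewK (key _ LM) (key _ LM') scalerN scaler_sumr -opprD -big_split.
congr (- _); apply: eq_bigr => E _ /=; rewrite scalerA -scalerDl; congr (_ *: _).
by rewrite -mxtraceZ -linearD /= scalemxAl -mulmxDl skewK.
Qed.

Lemma mxtrace_delta_mul a b E : \tr (delta_mx b a *m E) = E a b.
Proof.
rewrite /mxtrace (bigD1 b) //= mxE (bigD1 a) //= !mxE !eqxx mul1r big1 => [|k ka].
  rewrite big1 ?addr0 // => k kb; rewrite mxE big1 // => l _.
  by rewrite mxE (negbTE kb) mul0r.
by rewrite mxE (negbTE ka) andbF mul0r.
Qed.

(** The expansion of the elementary matrix E_ba, read in entry (c, d). *)
Lemma casimir_unitary B : orthonormal_basis (unitary_group R n) B -> casimir 0 B.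
Proof.
move=> oB a b c d.
have /matrixP/(_ c d) := basis_expansion (G := unitary_group R n) (fun X h => h) oB
  (skew_reP (delta_mx b a)) (skew_imP _).
under eq_bigr do rewrite mxtrace_delta_mul.
rewrite !mxE summxE => /eqP; rewrite -eqr_oppLR => /eqP; under eq_bigr do rewrite mxE.
by rewrite mul0r mul0r add0r => <-; rewrite -natrM mulnb andbC [d == a]eq_sym [c == b]eq_sym.
Qed.

(** Here the expansion applies to the traceless part of E_ba, whose correction by a
    multiple of the identity produces the coefficient 1/n. *)
Lemma casimir_special_unitary B : (0 < n)%N ->
  orthonormal_basis (special_unitary_group R n) B -> casimir (n%:R^-1) B.
Proof.
move=> n0 oB a b c d.
have n0' : n%:R != 0 :> C by rewrite pnatr_eq0 -lt0n.
pose M : 'M[C]_n := delta_mx b a - ((b == a)%:R / n%:R)%:M.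
have trM : \tr M = 0.
  by rewrite raddfB /= mxtrace_scalar -[_ *+ n]mulr_natr divfK //
    -[delta_mx _ _]mulmx1 mxtrace_delta_mul mxE eq_sym subrr.
have trMC : \tr (M ^t*) = 0 by rewrite tr_trmxC trM rmorph0.
have L1 : lie_algebra (special_unitary_group R n) (skew_re M).
  by split; [exact: skew_reP | rewrite linearZ linearB /= trM trMC subrr mulr0].
have L2 : lie_algebra (special_unitary_group R n) (skew_im M).
  by split; [exact: skew_imP | rewrite linearZ linearD /= trM trMC addr0 mulr0].
have := basis_expansion (G := special_unitary_group R n) (fun X h => h.1) oB L1 L2.
have -> : \sum_(E <- B) \tr (M *m E) *: E = \sum_(E <- B) E a b *: E.
  rewrite !big_seq; apply: eq_bigr => E; case: oB => BL _ _ /BL [_ trE].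
  by rewrite mulmxBl raddfB /= mxtrace_delta_mul mul_scalar_mx mxtraceZ trE mulr0 subr0.
move=> /matrixP/(_ c d); rewrite !mxE summxE => /eqP; rewrite -eqr_oppLR => /eqP.
under eq_bigr do rewrite mxE.
move=> <-; rewrite [b == a]eq_sym [d == a]eq_sym [c == b]eq_sym -natrM mulnb andbC.
by rewrite opprB -[_ *+ (c == d)]mulr_natr [_ / n%:R]mulrC.
Qed.
End Casimir.

(** * The Laplacian as a sum of second derivatives *)

Section Jets.
Variables (R : realType) (n : nat).
Local Notation C := R[i].
Local Notation re := (@complex.Re R).
Local Notation im := (@complex.Im R).
Implicit Types (f g L : 'M[C]_n -> C) (X Y Z z w : 'M[C]_n) (B : seq 'M[C]_n).
Implicit Types (D : 'M[C]_n -> 'M[C]_n -> C) (H : 'M[C]_n -> 'M[C]_n -> 'M[C]_n -> C).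

Variable W : set 'M[C]_n.
Hypothesis Wopen : forall z X, W z ->
  \forall t \near (0 : R), W (z *m mexp (t%:C *: X)).

(** D X and H X Y are the derivatives of f along X and of D X along Y.  The real
    linearity in X identifies the gradient of f in an orthonormal basis. *)
Record jet f D H : Prop := Jet {
  jet1 : forall z X, W z -> lie_derive f X z (D X z);
  jet2 : forall z X Y, W z -> lie_derive (D X) Y z (H X Y z);
  jetL : forall z (a : R) X Y, W z -> D (a%:C *: X + Y) z = a%:C * D X z + D Y z }.

Section Tau.
Variables (G : matrix_group R n).
Hypotheses (skewG : forall X, lie_algebra G X -> X + X ^t* = 0)
  (G0 : lie_algebra G 0)
  (GDZ : forall (a : R) X Y, lie_algebra G X -> lie_algebra G Y ->
     lie_algebra G (a%:C *: X + Y)).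

Definition chosen_basis := xget [::] [set B | orthonormal_basis G B].

Lemma chosen_basisP : orthonormal_basis G chosen_basis.
Proof.
have [B hB] := orthonormal_basis_exists G0 GDZ.
by apply: (@xgetPex _ [::] [set B | orthonormal_basis G B]); exists B.
Qed.

(** This is nabla_E E = 0, tested against V: ad E is skew for the metric. *)
Lemma koszul_diag E V : lie_algebra G E -> koszul E V E = 0.
Proof.
move=> /skewG /eqP; rewrite addrC addr_eq0 => /eqP sE.
have EE : bracket E E = 0 by rewrite /bracket subrr.
have VE : bracket V E = - bracket E V by rewrite /bracket opprB.
rewrite /koszul EE VE metric0l metricNl opprK addr0.
suff -> : metric (bracket E V) E = 0 by rewrite addr0 mul0r.
rewrite /metric sE /bracket mulmxN mulmxBl raddfN raddfB /=.
by rewrite mxtrace_mulC -[V *m E *m E]mulmxA [\tr (V *m _)]mxtrace_mulC mulmxA subrr oppr0.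
Qed.

Lemma lie_deriv_field_val (V : 'M[C]_n -> 'M[C]_n) X z (V' : 'M[C]_n) :
  (forall a b, lie_derive (fun w => V w a b) X z (V' a b)) -> lie_deriv_field V X z = V'.
Proof.
move=> h; apply/matrixP => a b; rewrite mxE /lie_deriv.
have [hr hi] := h a b.
rewrite !derive1E (@derive_val _ _ _ _ _ _ _ hr) (@derive_val _ _ _ _ _ _ _ hi).
by case: (V' a b).
Qed.

Lemma lie_derive_sum (I : Type) (s : seq I) (F : I -> 'M[C]_n -> C) (d : I -> C) X z :
  (forall i, lie_derive (F i) X z (d i)) ->
  lie_derive (fun w => \sum_(i <- s) F i w) X z (\sum_(i <- s) d i).
Proof. exact: cderive0_sum. Qed.

(** The operator acts on real functions, so p stands for the real or the imaginary
    part.  On W the gradient is the sum of the p (D F) F over the basis; as W is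
    open along the curves, this formula can be differentiated once more. *)
Lemma laplace_jet (p : C -> R) f D H z :
  (forall (a : R) x y, p (a%:C * x + y) = a * p x + p y) ->
  (forall h d, cderive0 h d -> is_derive (0 : R) (1 : R) (fun t => p (h t)) (p d)) ->
  jet f D H -> W z ->
  laplace G (fun w => p (f w)) z = p (\sum_(E <- chosen_basis) H E E z).
Proof.
move=> pL pder [j1 j2 jL] Wz; have [BL oB Bexp] := chosen_basisP.
have p0 : p 0 = 0 by have := pL 1 0 0; rewrite mul1r mul1r addr0; lra.
have lieE w X : W w -> lie_deriv (fun w => p (f w)) X w = p (D X w).
  move=> Ww; have h := pder _ _ (j1 w X Ww).
  by rewrite /lie_deriv derive1E (@derive_val _ _ _ _ _ _ _ h).
have D0 w : W w -> D 0 w = 0.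
  move=> Ww; have := jL w 1 0 0 Ww; rewrite scaler0 addr0 mul1r => /eqP.
  by rewrite -subr_eq subrr eq_sym => /eqP.
have Dsum w (c : 'M[C]_n -> R) (s : seq 'M[C]_n) : W w ->
    p (D (\sum_(E <- s) (c E)%:C *: E) w) = \sum_(E <- s) c E * p (D E w).
  move=> Ww; elim: s => [|E s IH]; first by rewrite !big_nil D0.
  by rewrite !big_cons jL // pL IH.
have gradE w : W w -> gradient G (fun w => p (f w)) w =
    \sum_(E <- chosen_basis) (p (D E w))%:C *: E.
  move=> Ww; rewrite /gradient; apply: xget_unique.
    split=> [|X LX]; first exact: (real_span_sum G0 GDZ).
    rewrite lieE // {2}(Bexp _ LX) Dsum // metric_suml; apply: eq_bigr => E _.
    by rewrite metricC mulrC.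
  move=> Y [LY YX]; rewrite (Bexp _ LY) !big_seq; apply: eq_bigr => E /BL LE.
  by rewrite YX // lieE.
have lcE E : E \in chosen_basis -> levi_civita (gradient G (fun w => p (f w))) E E z = p (H E E z).
  move=> /[dup] EB /BL LE; rewrite /levi_civita koszul_diag // addr0.
  rewrite (@lie_deriv_field_val _ _ _ (\sum_(F <- chosen_basis) (p (H F E z))%:C *: F)).
    case/(nthP 0): EB => i iB Ei.
    by have := orthonormal_sum (fun F => p (H F E z)) oB iB; rewrite Ei.
  move=> a b; rewrite summxE.
  apply: (@lie_derive_near _ _ (fun w => \sum_(F <- chosen_basis) (p (D F w))%:C * F a b)).
    apply: filterS (Wopen E Wz) => t Wt; rewrite gradE // summxE.
    by apply: eq_bigr => F _; rewrite mxE.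
  apply: lie_derive_sum => F; rewrite mxE; apply: cderive0Mcst.
  by split=> /=; [apply: pder; exact: j2 | exact: is_derive_cst].
rewrite /laplace /divergence -/chosen_basis big_seq (eq_bigr _ lcE) -big_seq.
have pD : {morph p : x y / x + y}.
  by move=> x y; rewrite -{1}[x]mul1r -[X in X * x]/((1 : R)%:C) pL mul1r.
by rewrite (big_morph p pD p0).
Qed.

Lemma tau_jet f D H z : jet f D H -> W z ->
  tau G f z = \sum_(E <- chosen_basis) H E E z.
Proof.
move=> jf Wz; rewrite /tau.
rewrite (laplace_jet (p := re) _ _ jf Wz); last 2 first.
- by move=> a [? ?] [? ?] /=; ring.
- by move=> h d [].
rewrite (laplace_jet (p := im) _ _ jf Wz).
- by case: (\sum_(E <- _) _).
- by move=> a [? ?] [? ?] /=; ring.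
- by move=> h d [].
Qed.
End Tau.

Section Lap.
Variable B : seq 'M[C]_n.

(** Here u and v stand for differentials at one point, as functions of the direction. *)
Definition kappa (u v : 'M[C]_n -> C) : C := \sum_(E <- B) u E * v E.

(** The differential is kept in the predicate because the product rule for the
    Laplacian needs it. *)
Definition has_lap f D L := exists2 H, jet f D H &
  forall z, W z -> \sum_(E <- B) H E E z = L z.

Lemma has_lap_ext f D L L' : (forall z, W z -> L z = L' z) ->
  has_lap f D L -> has_lap f D L'.
Proof. by move=> LL [H jH hH]; exists H => // z Wz; rewrite hH ?LL. Qed.

Lemma lie_deriveMcst e f X z d : lie_derive f X z d -> lie_derive (fun w => f w * e) X z (d * e).
Proof. exact: cderive0Mcst. Qed.

Lemma has_lap_coord a b : has_lap (fun z => z a b) (fun X z => (z *m X) a b)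
  (fun z => \sum_(E <- B) (z *m E *m E) a b).
Proof.
exists (fun X Y z => (z *m Y *m X) a b) => //; split.
- by move=> z X _; exact: lie_derive_coord.
- move=> z X Y _; rewrite mxE.
  have -> : (fun w : 'M[C]_n => (w *m X) a b) = (fun w => \sum_j w a j * X j b).
    by apply/funext => w; rewrite mxE.
  by apply: lie_derive_sum => j; apply: lie_deriveMcst; exact: lie_derive_coord.
- by move=> z c X Y _; rewrite mulmxDr -scalemxAr !mxE.
Qed.

Lemma has_lapD f g D D' L L' : has_lap f D L -> has_lap g D' L' ->
  has_lap (fun z => f z + g z) (fun X z => D X z + D' X z) (fun z => L z + L' z).
Proof.
move=> [H [f1 f2 fL] hH] [H' [g1 g2 gL] hH'].
exists (fun X Y z => H X Y z + H' X Y z); last first.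
  by move=> z Wz; rewrite big_split /= hH ?hH'.
split=> [z X Wz|z X Y Wz|z a X Y Wz].
- by apply: lie_deriveD; [exact: f1|exact: g1].
- by apply: lie_deriveD; [exact: f2|exact: g2].
- by rewrite fL // gL //; ring.
Qed.

Lemma has_lapZ c f D L : has_lap f D L ->
  has_lap (fun z => c * f z) (fun X z => c * D X z) (fun z => c * L z).
Proof.
move=> [H [f1 f2 fL] hH]; exists (fun X Y z => c * H X Y z).
  split=> [z X Wz|z X Y Wz|z a X Y Wz].
  - by apply: lie_derive_cstM; exact: f1.
  - by apply: lie_derive_cstM; exact: f2.
  - by rewrite fL //; ring.
by move=> z Wz; rewrite -mulr_sumr hH.
Qed.

Lemma has_lapM f g D D' L L' : has_lap f D L -> has_lap g D' L' ->
  has_lap (fun z => f z * g z) (fun X z => D X z * g z + f z * D' X z)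
    (fun z => L z * g z + 2 * kappa (D^~ z) (D'^~ z) + f z * L' z).
Proof.
move=> [H [f1 f2 fL] hH] [H' [g1 g2 gL] hH'].
exists (fun X Y z => (H X Y z * g z + D X z * D' Y z) + (D Y z * D' X z + f z * H' X Y z)).
  split=> [z X Wz|z X Y Wz|z a X Y Wz].
  - by apply: lie_deriveM; [exact: f1|exact: g1].
  - apply: lie_deriveD; apply: lie_deriveM; solve [exact: f1|exact: g1|exact: f2|exact: g2].
  - by rewrite fL // gL //; ring.
move=> z Wz; rewrite !big_split /= -mulr_suml -mulr_sumr hH // hH' // /kappa; ring.
Qed.

Lemma has_lapV f D L : (forall z, W z -> f z != 0) -> has_lap f D L ->
  has_lap (fun z => (f z)^-1) (fun X z => - (D X z / (f z) ^+ 2))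
    (fun z => - (L z / f z ^+ 2) + 2 * kappa (D^~ z) (D^~ z) / f z ^+ 3).
Proof.
move=> f0 [H [f1 f2 fL] hH].
exists (fun X Y z => - (H X Y z / f z ^+ 2) + 2 * (D X z * D Y z) / f z ^+ 3).
  split=> [z X Wz|z X Y Wz|z a X Y Wz].
  - by apply: lie_deriveV; [exact: f0|exact: f1].
  - have -> : (fun w => - (D X w / f w ^+ 2)) = (fun w => -1 * (D X w * ((f w)^-1 * (f w)^-1))).
      by apply/funext => w; rewrite mulN1r expr2 invfM.
    apply: lie_derive_eq.
      apply: lie_derive_cstM; apply: lie_deriveM; first exact: f2.
      by apply: lie_deriveM; (apply: lie_deriveV; [exact: f0|exact: f1]).
    by have := f0 z Wz; move: (f z) => x x0; field.
  - by rewrite fL //; ring.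
move=> z Wz; rewrite big_split /= sumrN -mulr_suml hH // -mulr_suml -mulr_sumr.
by rewrite /kappa.
Qed.

Lemma kappaC (u v : 'M[C]_n -> C) : kappa u v = kappa v u.
Proof. by apply: eq_bigr => E _; rewrite mulrC. Qed.

Lemma kappaDl (u v w : 'M[C]_n -> C) : kappa (fun E => u E + v E) w = kappa u w + kappa v w.
Proof. by rewrite -big_split; apply: eq_bigr => E _; rewrite mulrDl. Qed.

Lemma kappaNl (u w : 'M[C]_n -> C) : kappa (fun E => - u E) w = - kappa u w.
Proof. by rewrite -sumrN; apply: eq_bigr => E _; rewrite mulNr. Qed.

Lemma kappaZl c (u w : 'M[C]_n -> C) : kappa (fun E => c * u E) w = c * kappa u w.
Proof. by rewrite mulr_sumr; apply: eq_bigr => E _; rewrite mulrA. Qed.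

Lemma kappaZr c (u w : 'M[C]_n -> C) : kappa (fun E => u E * c) w = c * kappa u w.
Proof. by rewrite mulr_sumr; apply: eq_bigr => E _; ring. Qed.

Variable eps : C.
Hypothesis casB : casimir eps B.

Lemma kappa_coord j a r c (z y : 'M[C]_n) : kappa (fun E => (z *m E) j a) (fun E => (y *m E) r c) =
  eps * (z j a * y r c) - z j c * y r a.
Proof.
transitivity (\sum_p \sum_q z j p * y r q * \sum_(E <- B) E p a * E q c).
  rewrite /kappa; under eq_bigr do rewrite !mxE mulr_suml.
  rewrite exchange_big; apply: eq_bigr => p _ /=.
  under eq_bigr do rewrite mulr_sumr.
  rewrite exchange_big; apply: eq_bigr => q _ /=; rewrite mulr_sumr.
  by apply: eq_bigr => E _; ring.
have delta (F : 'I_n -> C) (x : 'I_n) : \sum_p F p * (p == x)%:R = F x.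
  rewrite (bigD1 x) //= eqxx mulr1 big1 ?addr0 // => p /negbTE ->; exact: mulr0.
have expand p q : z j p * y r q * \sum_(E <- B) E p a * E q c =
    z j p * eps * (p == a)%:R * y r q * (q == c)%:R
    - z j p * (p == c)%:R * y r q * (q == a)%:R.
  by rewrite casB [a == q]eq_sym; ring.
under eq_bigr => p _ do under eq_bigr => q _ do rewrite expand.
under eq_bigr => p _ do rewrite big_split /= sumrN !delta.
rewrite big_split /= sumrN.
under eq_bigr => p _ do rewrite mulrAC.
under [X in _ - X]eq_bigr => p _ do rewrite mulrAC.
by rewrite !delta; ring.
Qed.

(** The second derivative of z_ja along E is the kappa-product of the row z E with
    the column E, so that [kappa_coord] applies with the identity as second matrix. *)
Lemma lap_coord j a z : \sum_(E <- B) (z *m E *m E) j a = (eps - n%:R) * z j a.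
Proof.
transitivity (\sum_q kappa (fun E => (z *m E) j q) (fun E => (1%:M *m E) q a)).
  rewrite /kappa exchange_big; apply: eq_bigr => E _ /=.
  by rewrite mxE; apply: eq_bigr => q _; rewrite mul1mx.
under eq_bigr do rewrite kappa_coord.
rewrite big_split /= sumrN.
under [X in _ - X]eq_bigr do rewrite !mxE eqxx mulr1.
rewrite sumr_const card_ord (bigD1 a) //= mxE eqxx big1 => [|q /negbTE qa].
  by rewrite addr0 -[_ *+ n]mulr_natl /=; ring.
by rewrite mxE qa !mulr0.
Qed.

End Lap.
End Jets.

(** * Two-by-two minors under the Laplacian *)

Section Minors.
Variables (R : realType) (n : nat).
Local Notation C := R[i].
Implicit Types (X Y Z z w : 'M[C]_n).

Definition dminor (j k a b : 'I_n) X z : C :=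
  ((z *m X) j a * z k b + z j a * (z *m X) k b)
  + -1 * ((z *m X) k a * z j b + z k a * (z *m X) j b).

Lemma minor2E j k a b : @minor2 R n j k a b = fun z => z j a * z k b + -1 * (z k a * z j b).
Proof. by apply/funext => z; rewrite mulN1r. Qed.

Lemma lie_derive_minor j k a b X z : lie_derive (minor2 j k a b) X z (dminor j k a b X z).
Proof.
rewrite minor2E.
apply: lie_deriveD; first by apply: lie_deriveM; exact: lie_derive_coord.
by apply: lie_derive_cstM; apply: lie_deriveM; exact: lie_derive_coord.
Qed.

Section Lap.
Variables (W : set 'M[C]_n) (B : seq 'M[C]_n) (eps : C).
Hypothesis casB : casimir eps B.

Lemma kappa_inv (u v : 'M[C]_n -> C) e :
  kappa B u (fun E => - (v E / e)) = - (e^-1 * kappa B u v).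
Proof. by rewrite kappaC kappaNl kappaZr kappaC. Qed.

Lemma kappa_mul (u v w : 'M[C]_n -> C) p q :
  kappa B (fun E => u E * q + p * v E) w = q * kappa B u w + p * kappa B v w.
Proof. by rewrite kappaDl kappaZr kappaZl. Qed.

Lemma has_lap_minor j k a b : has_lap W B (minor2 j k a b) (dminor j k a b)
  (fun z => (4 * eps + 2 - 2 * n%:R) * minor2 j k a b z).
Proof.
rewrite [X in has_lap _ _ X]minor2E.
apply: has_lap_ext; last first.
  apply: has_lapD; first by apply: has_lapM; exact: has_lap_coord.
  by apply: has_lapZ; apply: has_lapM; exact: has_lap_coord.
by move=> z _ /=; rewrite !(lap_coord casB) !(kappa_coord casB) /minor2; ring.
Qed.

(** The action of the Casimir tensor on the columns of a pair of minors: each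
    column of one is exchanged with each column of the other. *)
Definition swap_sum (j k r s a b c d : 'I_n) z : C :=
  minor2 j k c b z * minor2 r s a d z + minor2 j k d b z * minor2 r s c a z
  + minor2 j k a c z * minor2 r s b d z + minor2 j k a d z * minor2 r s c b z.

Lemma kappa_minor j k r s a b c d z :
  kappa B ((dminor j k a b)^~ z) ((dminor r s c d)^~ z) =
  4 * eps * minor2 j k a b z * minor2 r s c d z - swap_sum j k r s a b c d z.
Proof.
rewrite /dminor !(kappaDl, kappaZl, kappaZr) ![kappa _ (fun E => (z *m E) _ _) _]kappaC.
rewrite !(kappaDl, kappaZl, kappaZr) !(kappa_coord casB) /swap_sum /minor2; ring.
Qed.

(** The Pluecker relation between the minors of two fixed rows. *)
Lemma swap_sum_same_rows j k a b c d z :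
  swap_sum j k j k a b c d z = 2 * minor2 j k a b z * minor2 j k c d z.
Proof. by rewrite /swap_sum /minor2; ring. Qed.

Lemma swap_sum_same_cols j k r s a b z :
  swap_sum j k r s a b a b z = 2 * minor2 j k a b z * minor2 r s a b z.
Proof. by rewrite /swap_sum /minor2; ring. Qed.

End Lap.

(** * Quotients of minors *)

Section Quotient.
Variables (j k r s a b c d : 'I_n).
Local Notation P := (minor2 j k).
Local Notation Q := (minor2 r s).
Definition dom_quot : set 'M[C]_n := [set z | Q c d z <> 0].

Lemma dom_quot_neq0 z : dom_quot z -> Q c d z != 0. Proof. by move=> /eqP. Qed.

Lemma dom_quot_open z X : dom_quot z -> \forall t \near (0 : R), dom_quot (z *m mexp (t%:C *: X)).
Proof.
move=> /dom_quot_neq0 /lie_derive_neq0 /(_ (lie_derive_minor r s c d X z)).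
by apply: filterS => t /eqP.
Qed.

Variables (B : seq 'M[C]_n) (eps : C).
Hypothesis casB : casimir eps B.

Definition dquot X z := dminor j k a b X z * (Q c d z)^-1
  + P a b z * - (dminor r s c d X z / Q c d z ^+ 2).

Lemma has_lap_quot : has_lap dom_quot B (fun z => P a b z / Q c d z) dquot
  (fun z => 2 * (swap_sum j k r s a b c d z - 2 * P a b z * Q c d z) / Q c d z ^+ 2).
Proof.
apply: has_lap_ext; last first.
  apply: has_lapM; first exact: (has_lap_minor _ casB).
  by apply: has_lapV => [z /dom_quot_neq0 //|]; exact: (has_lap_minor _ casB).
move=> z /dom_quot_neq0 Q0 /=.
rewrite kappa_inv !(kappa_minor casB) swap_sum_same_rows.
by move: Q0; move: (P a b z) (Q c d z) (swap_sum _ _ _ _ _ _ _ _ _) => p q s0 q0; field.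
Qed.

Definition dswap X z : C :=
  (((dminor j k c b X z * Q a d z + P c b z * dminor r s a d X z)
   + (dminor j k d b X z * Q c a z + P d b z * dminor r s c a X z))
   + (dminor j k a c X z * Q b d z + P a c z * dminor r s b d X z))
   + (dminor j k a d X z * Q c b z + P a d z * dminor r s c b X z).

(** The kappa-products of the four pairs of factors add up to 4 eps S - Omega S,
    and Omega S = 4 P Q + 4 sigma(P Q) - 2 S by the quadratic relation satisfied by
    the exchange operator. *)
Lemma has_lap_swap_sum W : has_lap W B (swap_sum j k r s a b c d) dswap
  (fun z => 2 * (4 * eps + 2 - 2 * n%:R) * swap_sum j k r s a b c d z
    + 2 * (4 * eps * swap_sum j k r s a b c d z -
       (4 * P a b z * Q c d z + 4 * P c d z * Q a b z - 2 * swap_sum j k r s a b c d z))).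
Proof.
apply: has_lap_ext; last first.
  by do 3!(apply: has_lapD; last by apply: has_lapM; exact: has_lap_minor);
     apply: has_lapM; exact: has_lap_minor.
move=> z _ /=; rewrite !(kappa_minor casB) /swap_sum /minor2; ring.
Qed.

(** Each factor of S is differentiated against Q.  The factors Q_xy have the rows of
    Q, so the Pluecker relation makes Q a factor of the result. *)
Lemma kappa_swap_minor z : kappa B (dswap^~ z) ((dminor r s c d)^~ z) =
  Q c d z * (8 * eps * swap_sum j k r s a b c d z - 3 * swap_sum j k r s a b c d z
     - 2 * P c d z * Q a b z).
Proof.
rewrite /dswap 3!kappaDl !kappa_mul !(kappa_minor casB) /swap_sum /minor2; ring.
Qed.

(** The function is 2 (S - 2 P Q) / Q^2, arranged as a combination of S / Q^2 and
    P / Q, the Laplacian of the latter being already known. *)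
Lemma has_lap_lap_quot : exists D, has_lap dom_quot B
  (fun z => 2 * (swap_sum j k r s a b c d z * ((Q c d z)^-1 * (Q c d z)^-1))
     + - 4 * (P a b z / Q c d z)) D (fun=> 0).
Proof.
have hV := has_lapV dom_quot_neq0 (has_lap_minor dom_quot casB r s c d).
eexists; apply: has_lap_ext; last first.
  apply: has_lapD; last by apply: has_lapZ; exact: has_lap_quot.
  apply: has_lapZ; apply: has_lapM; first exact: has_lap_swap_sum.
  by apply: has_lapM; exact: hV.
move=> z /dom_quot_neq0 Q0 /=.
rewrite [kappa _ (dswap^~ z) _]kappaC kappa_mul ![kappa _ _ (dswap^~ z)]kappaC !kappa_inv.
(* The derivative of 1/Q is -dQ / Q^2, which is taken out on both sides. *)
rewrite ![kappa _ (fun E => - _) _]kappaC !kappa_inv kappa_swap_minor.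
rewrite !(kappa_minor casB) swap_sum_same_rows.
move: Q0; move: (P a b z) (Q c d z) (swap_sum _ _ _ _ _ _ _ _ _) => p q S q0.
by field.
Qed.

End Quotient.
End Minors.

(** * A special unitary matrix with nonzero Laplacian *)

Section Witness.
Variables (R : realType) (n : nat).
Local Notation C := R[i].
Implicit Types (M z : 'M[C]_n).

(** The numerator of tau(P / Q), up to the factor 2. *)
Definition obstruction (j k r s a b c d : 'I_n) z : C :=
  swap_sum j k r s a b c d z - 2 * minor2 j k a b z * minor2 r s c d z.

Definition witness (j k r s a b c d : 'I_n) := exists z : 'M[C]_n,
  [/\ z \is unitarymx, \det z = 1, minor2 r s c d z != 0
    & obstruction j k r s a b c d z != 0].

Lemma perm_onto (T : finType) (s t : seq T) : uniq s -> uniq t -> size s = size t ->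
  exists p : {perm T}, map p s = t.
Proof.
elim: s t => [|x s IH] [|y t] //=; first by exists 1%g.
move=> /andP[xs us] /andP[yt ut] [] /(IH _ us ut)[p pst].
exists (p * tperm (p x) y)%g; rewrite permM tpermL; congr (_ :: _).
rewrite -pst; apply/eq_in_map => i si; rewrite permM tpermD //.
  by apply: contraNneq xs => /perm_inj ->.
by apply: contraNneq yt => ->; rewrite -pst map_f.
Qed.

Lemma unitary_col_perm (p : {perm 'I_n}) M : M \is unitarymx -> col_perm p M \is unitarymx.
Proof.
move=> /unitarymxP UM; apply/unitarymxP; rewrite -UM; apply/matrixP => i l; rewrite !mxE.
by rewrite [RHS](reindex_inj (@perm_inj _ p)); apply: eq_bigr => m _; rewrite !mxE.
Qed.


(** The reflection in the hyperplane orthogonal to e_j - 2 e_r.  It is a rational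
    unitary matrix whose entries in the rows and columns j, r are all nonzero, namely
    3/5, 4/5, 4/5, -3/5, and it fixes the other basis vectors.  The factor 2/5 is 2
    over the squared length of e_j - 2 e_r. *)
Definition reflection (j r : 'I_n) : 'M[C]_n :=
  let u := delta_mx j 0 - 2 *: delta_mx r 0 : 'cV[C]_n in
  1%:M - (2 / 5) *: (u *m u^T).

Lemma reflectionE j r i l : reflection j r i l = (i == l)%:R
  - 2 / 5 * ((i == j)%:R - 2 * (i == r)%:R) * ((l == j)%:R - 2 * (l == r)%:R).
Proof. by rewrite !mxE big_ord1 !mxE !andbT; ring. Qed.

Lemma reflection_unitary j r : j != r -> reflection j r \is unitarymx.
Proof.
move=> jr; apply/unitarymxP.
have -> : (reflection j r) ^t* = reflection j r.
  apply/matrixP => i l; rewrite 2!mxE !reflectionE.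
  rewrite rmorphB !rmorphM fmorphV !rmorphB !rmorphM !rmorph_nat eq_sym; ring.
rewrite /reflection; set u := _ - _ *: delta_mx r 0.
have uu : u^T *m u = 5%:M.
  apply/matrixP => a b; rewrite !ord1 mxE (bigD1 j) //= (bigD1 r) 1?eq_sym //=.
  rewrite big1 => [|i /andP[ij ir]].
    by rewrite !mxE !eqxx (negbTE jr) eq_sym (negbTE jr) /=; ring.
  by rewrite !mxE (negbTE ij) (negbTE ir) /=; ring.
have AA : u *m u^T *m (u *m u^T) = 5 *: (u *m u^T).
  by rewrite mulmxA -(mulmxA u) uu mul_mx_scalar scalemxAl.
move: AA; move: (u *m u^T) => A AA.
rewrite mulmxBl mul1mx mulmxBr mulmx1 -scalemxAl -scalemxAr AA.
by apply/matrixP => i l; rewrite !mxE; field.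
Qed.

(** Multiplication by an n-th root of 1 / det M, which has norm 1. *)
Lemma normalize_det M : (0 < n)%N -> M \is unitarymx ->
  exists2 e : C, e != 0 & (e *: M \is unitarymx) /\ \det (e *: M) = 1.
Proof.
move=> n0 UM.
have nD : `|\det M| = 1.
  have /unitarymxP/(congr1 determinant) := UM.
  rewrite det_mulmx det1 -det_tr det_map_mx -det_tr -normCK => /eqP.
  by rewrite pexpr_eq1 // => /eqP.
have D0 : \det M != 0 by rewrite -normr_gt0 nD.
pose e := n.-root ((\det M)^-1).
have en : e ^+ n = (\det M)^-1 by rewrite /e rootCK.
have ne : `|e| = 1.
  by apply/eqP; rewrite -(@pexpr_eq1 _ _ n) // -normrX en normfV nD invr1.
exists e; first by rewrite -normr_gt0 ne.
split; last by rewrite detZ en mulVf.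
apply/unitarymxP; move/unitarymxP: UM => UM.
have -> : (e *: M) ^t* = e^* *: M ^t*.
  by apply/matrixP => i l; rewrite !mxE rmorphM.
by rewrite -scalemxAl -scalemxAr UM scalerA -normCK ne expr1n scale1r.
Qed.


(** Since both functions are homogeneous, the determinant condition costs nothing. *)
Lemma witness_scale j k r s a b c d z : (0 < n)%N -> z \is unitarymx ->
  minor2 r s c d z != 0 -> obstruction j k r s a b c d z != 0 ->
  witness j k r s a b c d.
Proof.
move=> n0 /(normalize_det n0)[e e0 [Uz dz]] Q0 T0; exists (e *: z); split=> //.
- rewrite (_ : minor2 _ _ _ _ _ = e ^+ 2 * minor2 r s c d z) ?mulf_neq0 ?expf_neq0 //.
  by rewrite /minor2 !mxE; ring.
rewrite (_ : obstruction _ _ _ _ _ _ _ _ _ = e ^+ 4 * obstruction j k r s a b c d z).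
  by rewrite mulf_neq0 ?expf_neq0.
by rewrite /obstruction /swap_sum /minor2 !mxE; ring.
Qed.

(** Exchanging rows or exchanging columns in a product of two minors amounts to the
    same, so the numerator is symmetric under transposition. *)
Lemma witness_tr j k r s a b c d : witness a b c d j k r s -> witness j k r s a b c d.
Proof.
move=> [z [Uz dz Q0 T0]]; exists z^T; split; rewrite ?trmx_unitary ?det_tr //.
  by move: Q0; congr (_ != 0); rewrite /minor2 !mxE mulrC [X in _ - X]mulrC; ring.
by move: T0; congr (_ != 0); rewrite /obstruction /swap_sum /minor2 !mxE; ring.
Qed.

Lemma witness_swapP j k r s a b c d : witness k j r s a b c d -> witness j k r s a b c d.
Proof.
move=> [z [Uz dz Q0 T0]]; exists z; split=> //; move: T0; rewrite -oppr_eq0.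
by congr (_ != 0); rewrite /obstruction /swap_sum /minor2; ring.
Qed.

Lemma witness_swapQ j k r s a b c d : witness j k s r a b c d -> witness j k r s a b c d.
Proof.
move=> [z [Uz dz Q0 T0]]; exists z; split=> //.
  by move: Q0; rewrite -oppr_eq0; congr (_ != 0); rewrite /minor2; ring.
move: T0; rewrite -oppr_eq0.
by congr (_ != 0); rewrite /obstruction /swap_sum /minor2; ring.
Qed.

Definition fixes M (k : 'I_n) := forall i, M i k = (i == k)%:R /\ M k i = (k == i)%:R.

Lemma fixes1 k : fixes 1%:M k. Proof. by move=> i; rewrite !mxE. Qed.

Lemma reflection_fixes j r k : k != j -> k != r -> fixes (reflection j r) k.
Proof.
by move=> /negbTE kj /negbTE kr i; rewrite !reflectionE kj kr; split; rewrite /=; ring.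
Qed.

Lemma neq_false (x y : 'I_n) : x != y -> ((x == y) = false) * ((y == x) = false).
Proof. by move=> xy; rewrite [y == x]eq_sym (negbTE xy). Qed.

(** If column b of z is the unit vector e_k and column d is e_s, all minors reduce to
    the block with rows j, r and columns a, c, where Q = z_rc and
    S - 2 P Q = z_jc z_ra - 2 z_ja z_rc.  The matrix z is obtained from M by moving
    columns with p. *)
Lemma witness_block (j k r s a b c d : 'I_n) M (p : {perm 'I_n}) :
  k != j -> k != r -> k != s -> s != j -> s != r ->
  b != a -> b != c -> b != d -> d != a -> d != c ->
  fixes M k -> fixes M s -> p b = k -> p d = s -> M \is unitarymx ->
  M r (p c) != 0 -> M j (p c) * M r (p a) - 2 * M j (p a) * M r (p c) != 0 ->
  witness j k r s a b c d.
Proof.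
move=> kj kr ks sj sr ba bc bd da dc Mk Ms pb pd UM Q0 T0.
pose z := col_perm p M.
have zb i : z i b = (i == k)%:R by rewrite mxE pb (Mk i).1.
have zd i : z i d = (i == s)%:R by rewrite mxE pd (Ms i).1.
have zk i : z k i = (b == i)%:R by rewrite mxE (Mk _).2 -pb inj_eq //; exact: perm_inj.
have zs i : z s i = (d == i)%:R by rewrite mxE (Ms _).2 -pd inj_eq //; exact: perm_inj.
have [ra rc ja jc] : [/\ z r a = M r (p a), z r c = M r (p c), z j a = M j (p a)
    & z j c = M j (p c)] by rewrite !mxE.
apply: (@witness_scale _ _ _ _ _ _ _ _ z).
- exact: leq_ltn_trans (ltn_ord j).
- exact: unitary_col_perm.
- by move: Q0; congr (_ != 0); rewrite -rc /minor2 !(zb, zd, zk, zs)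
    !(eqxx, neq_false kr, neq_false ks, neq_false sr, neq_false dc) /=; ring.
by move: T0; congr (_ != 0);
  rewrite -rc -ja -jc -ra /obstruction /swap_sum /minor2 !(zb, zd, zk, zs)
  !(eqxx, neq_false kj, neq_false kr, neq_false ks, neq_false sj, neq_false sr, neq_false ba,
    neq_false bc, neq_false bd, neq_false da, neq_false dc) /=; ring.
Qed.

Lemma unitary1 : (1%:M : 'M[C]_n) \is unitarymx.
Proof. by apply/unitarymxP; rewrite mul1mx trmx1 map_mx1. Qed.

(** If j, r and a, c are both distinct or both equal, a permutation matrix suffices.
    If a = c and j differs from r, the entries z_ja and z_ra of the same column
    must both be nonzero, which the reflection achieves. *)
Lemma witness_core (j k r s a b c d : 'I_n) :
  k != j -> k != r -> k != s -> s != j -> s != r ->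
  b != a -> b != c -> b != d -> d != a -> d != c ->
  j != r \/ a = c -> witness j k r s a b c d.
Proof.
move=> kj kr ks sj sr ba bc bd da dc jr.
have block := @witness_block j k r s a b c d _ _ kj kr ks sj sr ba bc bd da dc.
have [ac|ac] := eqVneq a c; last first.
  case: jr => [jr|/eqP]; last by rewrite (negbTE ac).
  have [p [pa pb pc pd]] : exists p : {perm 'I_n}, [/\ p a = j, p b = k, p c = r & p d = s].
    have [||//|p [pa pb pc pd]] := @perm_onto _ [:: a; b; c; d] [:: j; k; r; s].
    - by rewrite /= !inE !(neq_false ba, neq_false bc, neq_false bd,
        neq_false da, neq_false dc, neq_false ac).
    - by rewrite /= !inE !(neq_false kj, neq_false kr, neq_false ks,
        neq_false sj, neq_false sr, neq_false jr).
    by exists p.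
  apply: (block 1%:M p) => //; rewrite ?pa ?pc ?mxE ?eqxx ?(neq_false jr) ?oner_neq0 //.
  - exact: fixes1.
  - exact: fixes1.
  - exact: unitary1.
  by rewrite mul0r sub0r mulr1 mulr1 oppr_eq0 pnatr_eq0.
subst c.
have [p [pa pb pd]] : exists p : {perm 'I_n}, [/\ p a = j, p b = k & p d = s].
  have [||//|p [pa pb pd]] := @perm_onto _ [:: a; b; d] [:: j; k; s].
  - by rewrite /= !inE !(neq_false ba, neq_false bd, neq_false da).
  - by rewrite /= !inE !(neq_false kj, neq_false ks, neq_false sj).
  by exists p.
have [rj|rj] := eqVneq j r.
  subst r; apply: (block 1%:M p) => //; rewrite ?pa ?mxE ?eqxx ?oner_neq0 //.
  - exact: fixes1.
  - exact: fixes1.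
  - exact: unitary1.
  by rewrite /= (_ : _ - _ = -1) ?oppr_eq0 ?oner_neq0 //; ring.
apply: (block (reflection j r) p) => //; rewrite ?pa ?reflectionE ?eqxx ?(neq_false rj).
- exact: reflection_fixes.
- exact: reflection_fixes.
- exact: reflection_unitary.
- rewrite (_ : _ - _ = 4 / 5) ?mulf_neq0 ?invr_eq0 ?pnatr_eq0 //=; by field.
rewrite (_ : _ - _ = - (12 / 25)) ?oppr_eq0 ?mulf_neq0 ?invr_eq0 ?pnatr_eq0 //=; by field.
Qed.

Lemma pair_diff (x y u v : 'I_n) : x <> y -> u <> v -> (x, y) <> (v, u) -> (x, y) <> (u, v) ->
  ([&& y != x, y != u & y != v] || [&& x != y, x != u & x != v]) &&
  ([&& v != u, v != x & v != y] || [&& u != v, u != x & u != y]).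
Proof.
move=> /eqP + /eqP + /eqP + /eqP; rewrite !xpair_eqE -!val_eqE /=; lia.
Qed.

(** By antisymmetry in the two rows, and in the two columns, of each minor, one may
    assume that k and b do not occur in Q and that s and d do not occur in P.  The
    case j = r with a and c distinct is the transpose of one treated before. *)
Lemma witness_exists (j k r s a b c d : 'I_n) :
  j <> k -> r <> s -> a <> b -> c <> d -> (j, k) <> (s, r) -> (a, b) <> (d, c) ->
  (j, k) <> (r, s) -> (a, b) <> (c, d) -> witness j k r s a b c d.
Proof.
move=> jk rs ab cd jksr abdc jkrs abcd.
have rows := pair_diff jk rs jksr jkrs; have cols := pair_diff ab cd abdc abcd.
have core j' k' r' s' a' b' c' d' : 
    [&& k' != j', k' != r' & k' != s'] -> [&& s' != r', s' != j' & s' != k'] ->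
    [&& b' != a', b' != c' & b' != d'] -> [&& d' != c', d' != a' & d' != b'] ->
    witness j' k' r' s' a' b' c' d'.
  move=> /and3P[? ? ?] /and3P[? ? ?] /and3P[? ? ?] /and3P[? ? ?].
  have [e|e] := eqVneq j' r'; last by apply: witness_core => //; left.
  by apply: witness_tr; apply: witness_core => //; right.
have coreP j' k' r' s' a' b' c' d' : 
    [&& k' != j', k' != r' & k' != s'] || [&& j' != k', j' != r' & j' != s'] ->
    [&& s' != r', s' != j' & s' != k'] || [&& r' != s', r' != j' & r' != k'] ->
    [&& b' != a', b' != c' & b' != d'] -> [&& d' != c', d' != a' & d' != b'] ->
    witness j' k' r' s' a' b' c' d'.
  move=> /orP[p|p] /orP[q|q] ? ?.
  - exact: core.
  - by apply: witness_swapQ; apply: core => //;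
      case/and3P: p q => ? ? ? /and3P[? ? ?]; exact/and3P.
  - by apply: witness_swapP; apply: core => //;
      case/and3P: p q => ? ? ? /and3P[? ? ?]; exact/and3P.
  - by apply: witness_swapP; apply: witness_swapQ; apply: core => //;
      case/and3P: p q => ? ? ? /and3P[? ? ?]; exact/and3P.
case/andP: rows => p1 p2; case/andP: cols => /orP[q1|q1] /orP[q2|q2].
- exact: coreP.
- by apply/witness_tr/witness_swapQ/witness_tr/coreP => //;
    case/and3P: q1 q2 => ? ? ? /and3P[? ? ?]; exact/and3P.
- by apply/witness_tr/witness_swapP/witness_tr/coreP => //;
    case/and3P: q1 q2 => ? ? ? /and3P[? ? ?]; exact/and3P.
- by apply/witness_tr/witness_swapP/witness_swapQ/witness_tr/coreP => //;
    case/and3P: q1 q2 => ? ? ? /and3P[? ? ?]; exact/and3P.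
Qed.

End Witness.

(** * Harmonicity and biharmonicity of P / Q *)

Section Main.
Variables (R : realType) (n : nat) (j k r s a b c d : 'I_n).
Local Notation C := R[i].
Local Notation f := (fun z : 'M[C]_n => minor2 j k a b z / minor2 r s c d z).
Local Notation W := (@dom_quot R n r s c d).

Variables (G : matrix_group R n) (eps : C).
Hypotheses (skewG : forall X, lie_algebra G X -> X + X ^t* = 0)
  (G0 : lie_algebra G 0)
  (GDZ : forall (t : R) X Y, lie_algebra G X -> lie_algebra G Y ->
     lie_algebra G (t%:C *: X + Y))
  (casG : casimir eps (chosen_basis G)).

Lemma jet_ext (g h : 'M[C]_n -> C) D H : (forall z, W z -> g z = h z) ->
  jet W g D H -> jet W h D H.
Proof.
move=> gh [j1 j2 jl]; split=> // z X Wz; apply: lie_derive_near (j1 z X Wz).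
by apply: filterS (dom_quot_open X Wz) => t; exact: gh.
Qed.

Lemma tau_quot z : W z ->
  tau G f z = 2 * obstruction j k r s a b c d z / minor2 r s c d z ^+ 2.
Proof.
move=> Wz; have [H jH hH] := has_lap_quot j k r s a b c d casG.
by rewrite (tau_jet (@dom_quot_open _ _ r s c d) skewG G0 GDZ jH Wz) hH.
Qed.

Lemma tau_tau_quot z : W z -> tau G (tau G f) z = 0.
Proof.
move=> Wz; have [D [H jH hH]] := has_lap_lap_quot j k r s a b c d casG.
have jT : jet W (tau G f) D H.
  apply: jet_ext jH => w /[dup] /dom_quot_neq0 Q0 /tau_quot ->.
  by rewrite /obstruction; field.
by rewrite (tau_jet (@dom_quot_open _ _ r s c d) skewG G0 GDZ jT Wz) hH.
Qed.

Hypotheses (jk : j <> k) (rs : r <> s) (ab : a <> b) (cd : c <> d)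
  (rows : (j, k) <> (s, r)) (cols : (a, b) <> (d, c)).
Hypothesis SU_G : forall z : 'M[C]_n, z \is unitarymx -> \det z = 1 -> carrier G z.

Lemma tau_quot_neq0 : (j, k) <> (r, s) -> (a, b) <> (c, d) ->
  exists z, [/\ carrier G z, W z & tau G f z <> 0].
Proof.
move=> h1 h2; have [z [Uz dz Q0 T0]] := witness_exists R jk rs ab cd rows cols h1 h2.
have Wz : W z by apply/eqP.
exists z; split=> //; first exact: SU_G.
by rewrite tau_quot //; apply/eqP; rewrite !mulf_neq0 ?invr_eq0 ?expf_neq0 ?pnatr_eq0.
Qed.

Lemma harmonic_quot : is_harmonic G W f <-> (j, k) = (r, s) \/ (a, b) = (c, d).
Proof.
split=> [h|h z Gz Wz]; last first.
  rewrite tau_quot // (_ : obstruction _ _ _ _ _ _ _ _ _ = 0) ?mulr0 ?mul0r //.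
  rewrite /obstruction; case: h => [][-> ->].
    by rewrite swap_sum_same_rows subrr.
  by rewrite swap_sum_same_cols subrr.
have [e|/eqP h1] := eqVneq (j, k) (r, s); first by left.
have [e|/eqP h2] := eqVneq (a, b) (c, d); first by right.
by have [z [Gz Wz []]] := tau_quot_neq0 h1 h2; exact: h.
Qed.

Lemma proper_biharmonic_quot :
  is_proper_biharmonic G W f <-> (j, k) <> (r, s) /\ (a, b) <> (c, d).
Proof.
split=> [[_ [z [Gz Wz tz]]]|[h1 h2]].
  have nh : ~ ((j, k) = (r, s) \/ (a, b) = (c, d)) by move=> /harmonic_quot/(_ z Gz Wz).
  by split=> e; apply: nh; [left|right].
by split; [move=> z _; exact: tau_tau_quot | exact: tau_quot_neq0].
Qed.

End Main.

Theorem theorem7p2 (R : realType) (n : nat)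
    (j k r s alpha beta gamma delta : 'I_n)
    (* both determinants are 2x2 minors with distinct rows and columns ... *)
    (jk : j <> k) (rs : r <> s) (alphabeta : alpha <> beta) (gammadelta : gamma <> delta)
    (* ... and a pair of indices is not compared with its own transposition *)
    (rows : (j, k) <> (s, r)) (cols : (alpha, beta) <> (delta, gamma)) :
  let P : 'M[R[i]]_n -> R[i] := minor2 j k alpha beta in
  let Q : 'M[R[i]]_n -> R[i] := minor2 r s gamma delta in
  let f : 'M[R[i]]_n -> R[i] := fun z => P z / Q z in
  let W_Q : set 'M[R[i]]_n := [set z | Q z <> 0] in
  let U := unitary_group R n in
  let SU := special_unitary_group R n in
  [/\ is_harmonic U W_Q f <-> (j, k) = (r, s) \/ (alpha, beta) = (gamma, delta),
      is_proper_biharmonic U W_Q f <-> (j, k) <> (r, s) /\ (alpha, beta) <> (gamma, delta),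
      is_harmonic SU W_Q f <-> (j, k) = (r, s) \/ (alpha, beta) = (gamma, delta)
    & is_proper_biharmonic SU W_Q f <-> (j, k) <> (r, s) /\ (alpha, beta) <> (gamma, delta)].
Proof.
move=> P Q f W_Q U SU.
have n0 : (0 < n)%N by exact: leq_ltn_trans (ltn_ord j).
have skewDZ (t : R) (X Y : 'M[R[i]]_n) : X + X ^t* = 0 -> Y + Y ^t* = 0 ->
    (t%:C *: X + Y) + (t%:C *: X + Y) ^t* = 0.
  move=> hX hY; have -> : (t%:C *: X + Y) ^t* = t%:C *: X ^t* + Y ^t*.
    by apply/matrixP => x y; rewrite !mxE rmorphD rmorphM /= -[Num.conj t%:C]/(t%:C^*)%C conjc_real.
  by rewrite addrACA -scalerDr hX hY scaler0 addr0.
have skew0 : (0 : 'M[R[i]]_n) + 0 ^t* = 0 by rewrite trmx0 map_mx0 addr0.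
have USk X : lie_algebra U X -> X + X ^t* = 0 by [].
have SUSk X : lie_algebra SU X -> X + X ^t* = 0 by case.
have U0 : lie_algebra U 0 by [].
have SU0 : lie_algebra SU 0 by split; rewrite ?mxtrace0.
have UDZ (t : R) X Y : lie_algebra U X -> lie_algebra U Y -> lie_algebra U (t%:C *: X + Y).
  exact: skewDZ.
have SUDZ (t : R) X Y : lie_algebra SU X -> lie_algebra SU Y -> lie_algebra SU (t%:C *: X + Y).
  move=> [hX tX] [hY tY]; split; first exact: skewDZ.
  by rewrite linearD linearZ /= tX tY mulr0 addr0.
have casU := casimir_unitary (chosen_basisP U0 UDZ).
have casSU := casimir_special_unitary n0 (chosen_basisP SU0 SUDZ).
split.
- by apply: harmonic_quot casU _ _ _ _ _ _ _.
- by apply: proper_biharmonic_quot casU _ _ _ _ _ _ _.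
- by apply: harmonic_quot casSU _ _ _ _ _ _ _.
- by apply: proper_biharmonic_quot casSU _ _ _ _ _ _ _.
Qed.
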